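(* Let $L\subseteq\Sigma^*$ be a slender regular language over a totally ordered finite alphabet $(\Sigma,<)$ (with $L$ infinite), and let $S=(L,\Sigma,<)$. A set $X\subseteq\mathbb{N}$ is $S$-recognizable if and only if $X$ is a finite union of arithmetic progressions.
   Context: An abstract numeration system is a triple $S=(L,\Sigma,<)$ with $L$ an infinite regular language over the totally ordered alphabet $(\Sigma,<)$; $\mathrm{rep}_S(n)$ denotes the $(n+1)$-st word of $L$ when $L$ is enumerated in genealogical order (shorter words first, words of equal length ordered lexicographically), $n\ge0$. A set $X\subseteq\mathbb{N}$ is $S$-recognizable if $\mathrm{rep}_S(X)$ is a regular language. A language $L$ is $d$-slender if it contains at most $d$ words of each length $n\ge0$, and slender if it is $d$-slender for some $d>0$. An arithmetic progression is a set $\{q+np: n\in\mathbb{N}\}$ with $p,q\in\mathbb{N}$. *)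

(* Defs.v *)
From mathcomp Require Import all_boot all_order.
From mathcomp Require Import mathcomp_extra boolp classical_sets functions cardinality.

Set Implicit Arguments.
Unset Strict Implicit.
Unset Printing Implicit Defensive.

Local Open Scope classical_set_scope.

(** Words over [Sigma] are sequences [seq Sigma], and languages are sets of
    words. *)

Record dfa (Sigma : finType) := Dfa {
  dfa_state : finType;
  dfa_init : dfa_state;
  dfa_final : {set dfa_state};
  dfa_trans : dfa_state -> Sigma -> dfa_state }.

Definition dfa_lang (Sigma : finType) (A : dfa Sigma) : set (seq Sigma) :=
  [set w | foldl (@dfa_trans _ A) (dfa_init A) w \in dfa_final A].

Definition regular (Sigma : finType) (L : set (seq Sigma)) : Prop :=
  exists A : dfa Sigma, L = dfa_lang A.

Definition d_slender (Sigma : finType) (d : nat) (L : set (seq Sigma)) : Prop :=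
  forall n, ([set w | L w /\ size w = n] #<= `I_d)%card.

Definition slender (Sigma : finType) (L : set (seq Sigma)) : Prop :=
  exists d, 0 < d /\ d_slender d L.

(** The total order on the alphabet is carried by its [finOrderType]
    structure. *)
Record numeration_system (disp : Order.disp_t) (Sigma : finOrderType disp) :=
  NumerationSystem {
    lang : set (seq Sigma);
    lang_regular : regular lang;
    lang_infinite : infinite_set lang }.

Definition genealogical_lt (disp : Order.disp_t) (Sigma : finOrderType disp)
    (v w : seq Sigma) : Prop :=
  size v < size w \/ size v = size w /\ (v < w :> seqlexi Sigma)%O.

(** The [(n+1)]-st word is the word of the language having exactly [n]
    predecessors in the language.  It exists because the language is infinite
    (see [repP]), so the default [[::]] of [xget] plays no role. *)
Definition rep (disp : Order.disp_t) (Sigma : finOrderType disp)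
    (S : numeration_system Sigma) (n : nat) : seq Sigma :=
  xget [::] [set w | lang S w /\
    ([set v | lang S v /\ genealogical_lt v w] #= `I_n)%card].

Definition recognizable (disp : Order.disp_t) (Sigma : finOrderType disp)
    (S : numeration_system Sigma) (X : set nat) : Prop :=
  regular (rep S @` X).

(** The common difference [p] may be [0], which gives the singleton [{q}]. *)
Definition arith_prog (p q : nat) : set nat := [set q + n * p | n in setT].

Definition finite_union_of_arith_progs (X : set nat) : Prop :=
  exists s : seq (nat * nat),
    X = \bigcup_(pq in [set` s]) arith_prog pq.1 pq.2.

Section Rep.
Context (disp : Order.disp_t) (Sigma : finOrderType disp).
Implicit Types (v w : seq Sigma) (S : numeration_system Sigma).

Lemma genealogical_ltxx w : ~ genealogical_lt w w.
Proof. by case=> [|[_]]; [rewrite ltnn | rewrite Order.POrderTheory.ltxx]. Qed.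

Lemma genealogical_lt_total v w :
  [\/ genealogical_lt v w, v = w | genealogical_lt w v].
Proof.
have [lt|gt|eq] := ltngtP (size v) (size w).
- by constructor 1; left.
- by constructor 3; left.
have [lt|gt|->] := @Order.TotalTheory.ltgtP _ (seqlexi Sigma) v w.
- by constructor 1; right.
- by constructor 3; right.
- by constructor 2.
Qed.

Lemma genealogical_lt_trans u v w :
  genealogical_lt u v -> genealogical_lt v w -> genealogical_lt u w.
Proof.
case=> [uv|[euv uv]] [vw|[evw vw]].
- by left; apply: ltn_trans vw.
- by left; rewrite -evw.
- by left; rewrite euv.
- by right; split; [rewrite euv | apply: Order.POrderTheory.lt_trans vw].
Qed.

Lemma genealogical_min (A : set (seq Sigma)) : A !=set0 ->
  exists2 w, A w & forall v, genealogical_lt v w -> ~ A v.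
Proof.
case=> w0 Aw0.
have ex : exists n, `[< exists2 w, A w & size w = n >].
  by exists (size w0); apply/asboolP; exists w0.
case: (ex_minnP ex) => n /asboolP[w1 Aw1 sw1] nmin.
have /eqP sw1' := sw1.
pose P (t : n.-tuple Sigma) := `[< A t >].
have P1 : P (Tuple sw1') by apply/asboolP.
have [t /asboolP At tmin] :=
  @Order.TotalTheory.arg_minP _ (seqlexi Sigma) _ _ P
    (fun t => tval t : seqlexi Sigma) P1.
exists (tval t) => // v [vt|[sv vt]] Av.
  by move: vt; rewrite size_tuple ltnNge nmin //; apply/asboolP; exists v.
rewrite size_tuple in sv; have /eqP sv' := sv.
have /tmin /= : P (Tuple sv') by apply/asboolP.
by rewrite Order.TotalTheory.leNgt vt.
Qed.

Lemma repP S n : lang S (rep S n) /\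
  ([set v | lang S v /\ genealogical_lt v (rep S n)] #= `I_n)%card.
Proof.
apply: (@xgetPex _ [::] [set w | lang S w /\
  ([set v | lang S v /\ genealogical_lt v w] #= `I_n)%card]) => /=.
suff [A [AL Acard Adown]] : exists A : set (seq Sigma), [/\ A `<=` lang S,
    (A #= `I_n)%card & forall v w, A w -> lang S v -> genealogical_lt v w -> A v].
  have /genealogical_min[w [Lw nAw] wmin] : (lang S `\` A) !=set0.
    apply/set0P/eqP; rewrite setD_eq0 => LA; apply: (@lang_infinite _ _ S).
    by apply: sub_finite_set LA _; exists n.
  exists w; split=> //; suff -> : [set v | lang S v /\ genealogical_lt v w] = A by [].
  apply/seteqP; split=> [v [Lv vw]|v Av].
    by apply: contrapT => nAv; apply: (wmin v vw).
  split; first exact: AL.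
  case: (genealogical_lt_total v w) => // [vw|wv]; first by rewrite vw in Av.
  by case: nAw; apply: Adown wv.
elim: n => [|n [A [AL Acard Adown]]].
  by exists set0; split=> //; rewrite II0.
have /genealogical_min[w [Lw nAw] wmin] : (lang S `\` A) !=set0.
  apply/set0P/eqP; rewrite setD_eq0 => LA; apply: (@lang_infinite _ _ S).
  by apply: sub_finite_set LA _; exists n.
exists (w |` A); split.
- by move=> v [->//|/AL].
- apply/eq_cardSP; exists w; first by left.
  suff -> : (w |` A) `\ w = A by [].
  apply/seteqP; split=> [v [[->|//] /(_ erefl)[]]|v Av].
  by split; [right | move=> vw; rewrite vw in Av].
- move=> v u [->|Au] Lv vu; right; last exact: Adown vu.
  by apply: contrapT => nAv; apply: (wmin v vu).
Qed.

End Rep.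

(* Main.v *)
(** If [rep S @` X] is accepted by an automaton [B] and [L] by an automaton
    [A], consider for each length [n] the sequence [b n] of bits telling which
    words of length [n] of [L], listed lexicographically, belong to
    [rep S @` X]; the characteristic sequence of [X] is the concatenation of the
    [b n].  Splitting off the first letter, the analogous sequences for all
    pairs of states of [A] and [B] at length [n + 1] are concatenations of
    those at length [n].  By slenderness [b n] has at most [d] bits, so only
    finitely many values occur and [b] is eventually periodic; hence so is [X].

    Conversely, a word [w] of [L] represents the number of words of [L] shorter
    than [w] plus its lexicographic rank among those of its length.  Splitting
    off the first letter expresses these counts, for all states of [A], as sums
    of the counts for the remaining suffix.  When [X] is eventually periodic
    they matter only up to an additive congruence of finite index, which gives
    a left congruence of finite index on words. *)

Require Import Defs.
From mathcomp Require Import all_boot all_order.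
From mathcomp Require Import boolp classical_sets cardinality.
From mathcomp Require Import zify.

Set Implicit Arguments.
Unset Strict Implicit.
Unset Printing Implicit Defensive.

Local Open Scope classical_set_scope.

(** * Eventually periodic sets and arithmetic progressions *)

Definition eventually_periodic (X : set nat) : Prop :=
  exists N p, 0 < p /\ forall n, N <= n -> X n <-> X (n + p).

Lemma eventually_periodic_mul (X : set nat) N p k n :
  (forall n, N <= n -> X n <-> X (n + p)) -> N <= n -> X n <-> X (n + k * p).
Proof.
move=> Xp Nn; elim: k => [|k IHk]; first by rewrite addn0.
by rewrite IHk mulSnr addnA; apply: Xp; lia.
Qed.

Lemma finite_union_eventually_periodic (X : set nat) :
  finite_union_of_arith_progs X -> eventually_periodic X.
Proof.
case=> s ->; elim: s => [|[p q] s [N [r [r0 IHs]]]].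
  by exists 0, 1; split=> // n _; split=> -[? ].
(* For [p = 0] the progression is [{q}], which has no element past [q], so any positive period
   serves there. *)
have [p' [p'0 Hp]] : exists p', 0 < p' /\
    forall n, q.+1 <= n -> arith_prog p q n <-> arith_prog p q (n + p').
  case: (posnP p) => [->|p0].
    by exists 1; split=> // n qn; split=> -[k _]; rewrite muln0; lia.
  exists p; split=> // n qn; split=> -[k _ kE].
    by exists k.+1 => //; rewrite -kE mulSnr addnA.
  by case: k kE => [|k] kE; [lia | exists k => //; rewrite mulSnr in kE; lia].
have cons_bigcup n : (\bigcup_(pq in [set` (p, q) :: s]) arith_prog pq.1 pq.2) n <->
    arith_prog p q n \/ (\bigcup_(pq in [set` s]) arith_prog pq.1 pq.2) n.
  split=> [[[a b] /=]|[Pn|[ab /= sab Pn]]].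
  - by rewrite inE => /orP[/eqP[-> ->]|sab Pn]; [left | right; exists (a, b)].
  - by exists (p, q) => //=; rewrite inE eqxx.
  - by exists ab => //=; rewrite inE sab orbT.
exists (maxn q.+1 N), (p' * r); split; first by rewrite muln_gt0 p'0.
move=> n; rewrite geq_max => /andP[qn Nn]; rewrite !cons_bigcup.
rewrite -(eventually_periodic_mul p' IHs Nn).
by rewrite [p' * r]mulnC -(eventually_periodic_mul r Hp qn).
Qed.

Lemma eventually_periodic_finite_union (X : set nat) :
  eventually_periodic X -> finite_union_of_arith_progs X.
Proof.
case=> N [p [p0 Xp]].
(* Elements below [N] become singletons; each element in the window of length [p] starting at [N]
   generates its residue class from there on. *)
exists ([seq (0, n) | n <- iota 0 N & `[< X n >]] ++
        [seq (p, n) | n <- iota N p & `[< X n >]]).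
apply/seteqP; split=> n.
  case: (ltnP n N) => [nN|Nn] Xn.
    exists (0, n); last by exists 0; rewrite //= addn0.
    rewrite /= mem_cat; apply/orP; left; apply: map_f.
    by rewrite mem_filter mem_iota nN !andbT; apply/asboolP.
  have nE : N + (n - N) %% p + (n - N) %/ p * p = n.
    by have := divn_eq (n - N) p; lia.
  exists (p, N + (n - N) %% p); last by exists ((n - N) %/ p).
  rewrite /= mem_cat; apply/orP; right; apply: map_f.
  rewrite mem_filter mem_iota leq_addr ltn_add2l ltn_mod p0 !andbT.
  apply/asboolP; apply/(eventually_periodic_mul ((n - N) %/ p) Xp).
    exact: leq_addr.
  by rewrite nE.
case=> -[a b] /=; rewrite mem_cat => /orP[] /mapP[m];
  rewrite mem_filter mem_iota => /andP[/asboolP Xm /andP[Nm _]] [-> ->] [k _ <-].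
  by rewrite muln0 addn0.
exact: (eventually_periodic_mul k Xp Nm).1 Xm.
Qed.

(** By pigeonhole a value repeats among the first [#|T| + 1]; since each value determines the next,
    the repetition propagates. *)
Lemma finite_orbit (T : finType) (F : nat -> T) :
  (forall n m, F n = F m -> F n.+1 = F m.+1) ->
  exists N p, 0 < p /\ forall n, N <= n -> F (n + p) = F n.
Proof.
move=> FS.
have /injectivePn[i [j neq_ij Fij]] : ~~ injectiveb (fun i : 'I_#|T|.+1 => F i).
  apply/negP => /injectiveP /leq_card; rewrite card_ord ltnn //.
wlog lt_ij : i j neq_ij Fij / i < j.
  move=> W; have [] := ltngtP i j; first exact: W.
    by move=> ji; apply: (W j i) => //; rewrite eq_sym.
  by move=> /val_inj eij; rewrite eij eqxx in neq_ij.
exists i, (j - i); split; first by rewrite subn_gt0.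
move=> n /subnK <-; elim: (n - i) => [|k IHk]; first by rewrite add0n subnKC // ltnW.
by rewrite !addSn; apply: FS.
Qed.

Lemma card_seq_set (T : choiceType) (s : seq T) :
  uniq s -> ([set` s] #= `I_(size s))%card.
Proof.
elim: s => [_|x s IHs /= /andP[xs us]].
  by rewrite (_ : [set` _] = set0) ?II0 //; apply/seteqP; split=> x.
apply/eq_cardSP; exists x; first by rewrite /= inE eqxx.
rewrite (_ : _ `\ x = [set` s]); first exact: IHs.
apply/seteqP; split=> y /=; first by rewrite inE => -[/orP[/eqP|]].
by rewrite inE => ys; split; [rewrite ys orbT | move=> yx; rewrite -yx ys in xs].
Qed.

(* A letter acts on [T] through a section of [f]; as [f] consumes words from
   the right, the automaton, reading from the left, composes these actions. *)
Lemma regular_left_congruence (Sigma T : finType) (f : seq Sigma -> T)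
    (P : set (seq Sigma)) :
  (forall a v w, f v = f w -> f (a :: v) = f (a :: w)) ->
  (forall v w, f v = f w -> P v -> P w) -> regular P.
Proof.
move=> fcons fP; pose r t := xget [::] [set w | f w = t].
(* Outside the range of [f], [r] is the default [[::]]; folding from [f [::]] never leaves that
   range. *)
have fr w : f (r (f w)) = f w.
  by apply: (@xgetPex _ [::] [set v | f v = f w]); exists w.
pose g a t := f (a :: r t).
have fE w : f w = foldr g (f [::]) w.
  by elim: w => //= a w <-; apply: fcons; rewrite fr.
pose A := Dfa (finfun id : {ffun T -> T})
  [set h : {ffun T -> T} | `[< P (r (h (f [::]))) >]]
  (fun h a => [ffun t => h (g a t)]).
exists A.
have foldlE (h : {ffun T -> T}) w t :
    (foldl (@dfa_trans _ A) h w : {ffun T -> T}) t = h (foldr g t w).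
  by elim: w h => //= a w IHw h; rewrite IHw ffunE.
apply/seteqP; split=> w; rewrite /dfa_lang /= inE foldlE ffunE -fE.
  by move=> Pw; apply/asboolP; apply: fP Pw; rewrite fr.
by move=> /asboolP; apply: fP; rewrite fr.
Qed.

(** * Listing and counting accepted words, state by state *)

Section OrderedWords.
Context (disp : Order.disp_t) (Sigma : finOrderType disp) (A : dfa Sigma).
Implicit Types (q : dfa_state A) (v w : seq Sigma).

Definition accepts q w := foldl (@dfa_trans _ A) q w \in dfa_final A.

Definition letters : seq Sigma := sort <=%O (enum Sigma).

Fixpoint words q n : seq (seq Sigma) :=
  if n is m.+1 then flatten [seq map (cons a) (words (dfa_trans q a) m) | a <- letters]
  else nseq (q \in dfa_final A) [::].

Definition lexlt : rel (seq Sigma) := fun v w => (v < w :> seqlexi Sigma)%O.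

Definition rank q w := count (lexlt^~ w) (words q (size w)).

Definition nb_words q n := size (words q n).

Definition nb_shorter q n := \sum_(k < n) nb_words q k.

Lemma mem_words q n w : (w \in words q n) = (size w == n) && accepts q w.
Proof.
elim: n q w => [|n IHn] q w /=.
  rewrite mem_nseq; case: w => [|a w]; last by rewrite andbF.
  by rewrite eqxx andbT /accepts /=; case: (q \in _).
apply/flatten_mapP/idP => [[a _ /mapP[v + ->]]|].
  by rewrite IHn /= eqSS.
case: w => // a w /= wP; exists a; first by rewrite mem_sort mem_enum.
by apply: map_f; rewrite IHn.
Qed.

Lemma lexlt_cons a b v w :
  lexlt (a :: v) (b :: w) = (a < b)%O || (a == b) && lexlt v w.
Proof.
rewrite /lexlt Order.SeqLexiOrder.ltxi_cons.
by case: (Order.TotalTheory.ltgtP a b).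
Qed.

(** In pairwise form sortedness splits along concatenation: distinct blocks compare by their first
    letter, and each block is sorted by induction. *)
Lemma words_sorted q n : sorted lexlt (words q n).
Proof.
have lexlt_trans : transitive lexlt.
  by move=> v u w; apply: Order.POrderTheory.lt_trans.
rewrite sorted_pairwise //; elim: n q => [|n IHn] q /=.
  by case: (q \in _).
have : pairwise <%O letters.
  rewrite -sorted_pairwise; last exact: Order.POrderTheory.lt_trans.
  by rewrite Order.TotalTheory.sort_lt_sorted enum_uniq.
elim: letters => //= a s IHs /andP[as_ /IHs{}IHs].
rewrite pairwise_cat IHs pairwise_map andbT; apply/andP; split; last first.
  by apply: sub_pairwise (IHn _) => v w vw /=; rewrite lexlt_cons eqxx vw orbT.
apply/allrelP => _ w /mapP[v _ ->] /flatten_mapP[b bs /mapP[u _ ->]].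
by rewrite lexlt_cons (allP as_ b bs).
Qed.

Lemma words_uniq q n : uniq (words q n).
Proof.
apply: (@sorted_uniq _ lexlt) (words_sorted q n) => [v u w|v].
  exact: Order.POrderTheory.lt_trans.
exact: Order.POrderTheory.ltxx.
Qed.

Lemma rank_nth q n i : i < nb_words q n -> rank q (nth [::] (words q n) i) = i.
Proof.
move=> lt_i; have := mem_nth [::] lt_i.
rewrite mem_words /rank => /andP[/eqP -> _].
exact: (@Order.POrderTheory.count_lt_nth _ (seqlexi Sigma)) (words_sorted q n) lt_i.
Qed.

Lemma nth_rank q w : accepts q w ->
  rank q w < nb_words q (size w) /\ nth [::] (words q (size w)) (rank q w) = w.
Proof.
move=> qw; have wP : w \in words q (size w) by rewrite mem_words eqxx.
have lt_i : index w (words q (size w)) < nb_words q (size w) by rewrite index_mem.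
by have := rank_nth lt_i; rewrite nth_index // => ->; rewrite nth_index.
Qed.

Lemma nb_words_cons q n :
  nb_words q n.+1 = \sum_(a <- letters) nb_words (dfa_trans q a) n.
Proof.
rewrite /nb_words /= size_flatten /shape -map_comp sumnE big_map.
by apply: eq_bigr => a _; rewrite /= size_map.
Qed.

(** A smaller first letter decides the comparison whatever follows, an equal one defers to the
    suffixes, a larger one contributes nothing. *)
Lemma rank_cons q a w :
  rank q (a :: w) = \sum_(b <- letters)
    if (b < a)%O then nb_words (dfa_trans q b) (size w)
    else if b == a then rank (dfa_trans q b) w else 0.
Proof.
rewrite /rank /= count_flatten -map_comp sumnE big_map; apply: eq_bigr => b _ /=.
rewrite count_map; under eq_count do rewrite /= lexlt_cons.
case: ifP => _; first by rewrite count_predT.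
by case: eqP => _; [| rewrite count_pred0].
Qed.

(** The predecessors are listed without repetition as [s]: all shorter accepted words, then the
    smaller ones of the same length. *)
Lemma card_genealogical_lt q w :
  ([set v | accepts q v /\ genealogical_lt v w] #=
    `I_(nb_shorter q (size w) + rank q w))%card.
Proof.
pose E n := flatten [seq words q k | k <- iota 0 n].
have EP n v : (v \in E n) = (size v < n) && accepts q v.
  apply/flatten_mapP/andP => [[k]|[vn qv]].
    by rewrite mem_iota mem_words add0n => /andP[_ kn] /andP[/eqP -> ->].
  by exists (size v); [rewrite mem_iota | rewrite mem_words eqxx].
have ES n : E n.+1 = E n ++ words q n.
  by rewrite /E -addn1 iotaD map_cat flatten_cat /= cats0.
have Eu n : uniq (E n).
  elim: n => // n IHn; rewrite ES cat_uniq IHn words_uniq andbT.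
  apply/hasPn => v; rewrite mem_words EP => /andP[/eqP -> _].
  by rewrite ltnn.
have Es n : size (E n) = nb_shorter q n.
  elim: n => [|n IHn]; first by rewrite /nb_shorter big_ord0.
  by rewrite ES size_cat IHn /nb_shorter big_ord_recr.
pose s := E (size w) ++ [seq v <- words q (size w) | lexlt v w].
have sP v : (v \in s) <-> accepts q v /\ genealogical_lt v w.
  rewrite mem_cat EP mem_filter mem_words; split.
    move=> /orP[/andP[vw qv]|/and3P[vw /eqP ev qv]]; split=> //; first by left.
    by right.
  by move=> [-> [->//|[-> vw]]]; rewrite /lexlt vw eqxx orbT.
have -> : [set v | accepts q v /\ genealogical_lt v w] = [set` s].
  by apply/seteqP; split=> v /sP.
have -> : nb_shorter q (size w) + rank q w = size s.
  by rewrite size_cat Es size_filter.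
apply: card_seq_set; rewrite cat_uniq Eu filter_uniq ?words_uniq // andbT.
apply/hasPn => v; rewrite mem_filter mem_words EP => /and3P[_ /eqP -> _].
by rewrite ltnn.
Qed.

End OrderedWords.

(** * Inverting the numeration map *)

Section Numeration.
Context (disp : Order.disp_t) (Sigma : finOrderType disp).
Context (S : numeration_system Sigma) (A : dfa Sigma) (SA : lang S = dfa_lang A).
Implicit Types (v w : seq Sigma) (X : set nat).

Local Notation q0 := (dfa_init A).

(** On the language this is the inverse of [rep S], computed from [A] alone. *)
Definition position w := nb_shorter q0 (size w) + rank q0 w.

Lemma card_predecessors w :
  ([set v | lang S v /\ genealogical_lt v w] #= `I_(position w))%card.
Proof. by rewrite SA; apply: card_genealogical_lt. Qed.

Lemma position_rep n : position (rep S n) = n.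
Proof.
apply/card_eq_II; have [_ cn] := repP S n.
by apply: card_eq_trans cn; rewrite card_eq_sym; apply: card_predecessors.
Qed.

(** Together with its own predecessors, [v] makes [position v + 1] predecessors of [w]. *)
Lemma position_lt v w : lang S v -> genealogical_lt v w -> position v < position w.
Proof.
move=> Lv vw; rewrite -card_le_II.
have /card_eqPle[_] :
    ((v |` [set u | lang S u /\ genealogical_lt u v]) #= `I_(position v).+1)%card.
  apply/eq_cardSP; exists v; first by left.
  rewrite (_ : _ `\ v = [set u | lang S u /\ genealogical_lt u v]).
    exact: card_predecessors.
  apply/seteqP; split=> [u [[->|//] /(_ erefl)[]]|u [Lu uv]].
  by split; [right | move=> eq_uv; case: (@genealogical_ltxx _ _ u); rewrite {2}eq_uv].
move/card_le_trans; apply.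
have /card_eqPle[+ _] := card_predecessors w.
apply: card_le_trans; apply: subset_card_le => u [->//|[Lu uv]]; split=> //.
exact: genealogical_lt_trans uv vw.
Qed.

Lemma rep_position w : lang S w -> rep S (position w) = w.
Proof.
move=> Lw; have [Lr _] := repP S (position w).
have := position_rep (position w).
by case: (genealogical_lt_total (rep S (position w)) w) => // /position_lt;
  [move/(_ Lr) | move/(_ Lw)] => + eqp; rewrite eqp ltnn.
Qed.

Lemma repK X n : (rep S @` X) (rep S n) <-> X n.
Proof.
split=> [[m Xm /(congr1 position)]|Xn]; last by exists n.
by rewrite !position_rep => <-.
Qed.

Lemma rep_image X w : (rep S @` X) w <-> lang S w /\ X (position w).
Proof.
split=> [[n Xn <-]|[Lw Xw]]; last by exists (position w) => //; apply: rep_position.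
by rewrite position_rep; case: (repP S n).
Qed.

End Numeration.

(** * From eventual periodicity to recognizability *)

Lemma regular_preimage_position (disp : Order.disp_t) (Sigma : finOrderType disp)
    (A : dfa Sigma) (X : set nat) : eventually_periodic X ->
  regular [set w | dfa_lang A w /\ X (position A w)].
Proof.
case=> N [p [p0 Xp]].
(* The class of [n] is a window of [X] shifted by [n], long enough that periodicity recovers the
   whole shift; hence equality of classes is an additive congruence. *)
pose c n := [ffun i : 'I_(N + p) => `[< X (n + i) >]].
have cP n m : c n = c m -> forall i, X (n + i) <-> X (m + i).
  move=> cnm; elim/ltn_ind=> i IHi; have [lt_i|ge_i] := ltnP i (N + p).
    have /ffunP/(_ (Ordinal lt_i)) := cnm; rewrite !ffunE /= => e.
    by split=> /asboolP; [rewrite e | rewrite -e] => /asboolP.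
  have ip : i = i - p + p by lia.
  rewrite ip !addnA; rewrite -!Xp; [|lia..].
  by apply: IHi; lia.
have cD n m n' m' : c n = c n' -> c m = c m' -> c (n + m) = c (n' + m').
  move=> /cP cn /cP cm; apply/ffunP => i; rewrite !ffunE; apply: asbool_equiv_eq.
  rewrite -addnA cn (_ : n' + (m + i) = m + (n' + i)); last by lia.
  by rewrite cm (_ : m' + (n' + i) = n' + m' + i) //; lia.
have c_sum I (s : seq I) (F G : I -> nat) : (forall i, c (F i) = c (G i)) ->
    c (\sum_(i <- s) F i) = c (\sum_(i <- s) G i).
  by move=> FG; apply: (big_ind2 (fun n m => c n = c m)) => // *; apply: cD.
pose Q := dfa_state A; pose q0 := dfa_init A.
pose f w := (c (nb_shorter q0 (size w)),
  [ffun q : Q => c (nb_words q (size w))],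
  [ffun q : Q => c (rank q w)],
  [ffun q : Q => accepts q w]).
have fP v w : f v = f w -> [/\ c (nb_shorter q0 (size v)) = c (nb_shorter q0 (size w)),
    forall q : Q, c (nb_words q (size v)) = c (nb_words q (size w)),
    forall q : Q, c (rank q v) = c (rank q w) &
    forall q : Q, accepts q v = accepts q w].
  move=> [-> /ffunP e1 /ffunP e2 /ffunP e3].
  by split=> // q; [have := e1 q | have := e2 q | have := e3 q]; rewrite !ffunE.
apply: (regular_left_congruence (f := f)) => [a v w /fP[es en er ea]|v w /fP[es _ er ea]].
  have en' (q : Q) : c (nb_words q (size v).+1) = c (nb_words q (size w).+1).
    by rewrite !nb_words_cons; apply: c_sum.
  congr (_, _, _, _).
  - by rewrite /nb_shorter !big_ord_recr; apply: cD.
  - by apply/ffunP => q; rewrite !ffunE en'.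
  - apply/ffunP => q; rewrite !ffunE !rank_cons; apply: c_sum => b.
    by case: ifP => // _; case: ifP.
  - by apply/ffunP => q; rewrite !ffunE [LHS]ea.
rewrite /= /dfa_lang /= -!/(accepts _ _) ea => -[-> Xv]; split=> //.
by move: Xv; have /cP/(_ 0) := cD _ _ _ _ es (er q0); rewrite !addn0 => ->.
Qed.

(** * From recognizability to eventual periodicity *)

Lemma take_flatten (I T : Type) (s : seq I) (F G : I -> seq T) d :
  (forall i, take d (F i) = take d (G i)) ->
  take d (flatten (map F s)) = take d (flatten (map G s)).
Proof.
have take2_cat (x y : seq T) : take d (x ++ y) = take d (take d x ++ take d y).
  rewrite !take_cat size_take; case: (ltnP d (size x)) => dx.
    by rewrite ltnn subnn take0 cats0.
  rewrite [in RHS]ltnNge dx /= [take d x]take_oversize // take_takel //.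
  exact: leq_subr.
by move=> FG; elim: s => //= i s IHs; rewrite take2_cat FG IHs -take2_cat.
Qed.

Section WordBits.
Context (disp : Order.disp_t) (Sigma : finOrderType disp) (A B : dfa Sigma).

Definition bits (q : dfa_state A) (r : dfa_state B) n :=
  [seq accepts r w | w <- words q n].

Lemma bits_cons q r n : bits q r n.+1 =
  flatten [seq bits (dfa_trans q a) (dfa_trans r a) n | a <- letters Sigma].
Proof.
rewrite /bits /= map_flatten -map_comp; congr flatten.
by apply: eq_map => a /=; rewrite -map_comp.
Qed.

(* Only the first [d] bits at each pair of states are kept, so that the
   sequence lives in a finite type; at the initial states nothing is lost. *)
Lemma bits_eventually_periodic d :
  (forall n, nb_words (dfa_init A) n <= d) ->
  exists N p, 0 < p /\ forall n, N <= n ->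
    bits (dfa_init A) (dfa_init B) (n + p) = bits (dfa_init A) (dfa_init B) n.
Proof.
move=> led.
have size_take_le (s : seq bool) : size (take d s) <= d by rewrite size_take_min geq_minl.
pose F n := [ffun qr : dfa_state A * dfa_state B => Bseq (size_take_le (bits qr.1 qr.2 n))].
have FE n q r : take d (bits q r n) = F n (q, r) by rewrite ffunE.
have [n m Fnm|N [p [p0 Fp]]] := @finite_orbit _ F.
  apply/ffunP => -[q r]; apply: val_inj; rewrite /= -!FE !bits_cons.
  by apply: take_flatten => a; rewrite !FE Fnm.
exists N, p; split=> // n Nn.
have take_bits k : take d (bits (dfa_init A) (dfa_init B) k) = bits (dfa_init A) (dfa_init B) k.
  by rewrite take_oversize // size_map; apply: led.
by rewrite -[LHS]take_bits -[RHS]take_bits !FE Fp.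
Qed.

End WordBits.

(** The period of [X] is the total length [P] of [p] consecutive blocks past [N]: adding [P] moves
    to the same offset, [p] blocks later. *)
Lemma concat_eventually_periodic (b : nat -> seq bool) (X : set nat) :
  (forall m, exists n i, i < size (b n) /\ m = \sum_(k < n) size (b k) + i) ->
  (forall n i, i < size (b n) ->
    X (\sum_(k < n) size (b k) + i) <-> nth false (b n) i) ->
  (exists N p, 0 < p /\ forall n, N <= n -> b (n + p) = b n) ->
  eventually_periodic X.
Proof.
move=> b_cover Xb [N [p [p0 bp]]]; pose s n := \sum_(k < n) size (b k).
have sS n : s n.+1 = s n + size (b n) by rewrite /s big_ord_recr.
have s_mono n m : n <= m -> s n <= s m.
  by move/subnK <-; elim: (m - n) => // k IHk; rewrite addSn sS; lia.
pose P := s (N + p) - s N.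
have sP n : N <= n -> s (n + p) = s n + P.
  move/subnK <-; elim: (n - N) => [|k IHk].
    by rewrite add0n /P subnKC // s_mono // leq_addr.
  by rewrite !addSn !sS IHk bp ?leq_addl //; lia.
have cover m : s N <= m -> exists n i, [/\ N <= n, i < size (b n) & m = s n + i].
  move=> Nm; have [n [i [lt_i mE]]] := b_cover m; exists n, i; split=> //.
  by rewrite leqNgt; apply/negP => /s_mono; rewrite sS; rewrite mE -/(s n) in Nm; lia.
exists (s N), P; split.
  (* The block containing position [s N] is nonempty, and its length is at most [P], so [P] is
     positive. *)
  have [n [i [Nn lt_i _]]] := cover _ (leqnn _).
  have : s n.+1 <= s (n + p) by apply: s_mono; lia.
  by rewrite sP // sS; lia.
move=> _ /cover[n [i [Nn lt_i ->]]]; rewrite addnAC -sP //.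
by rewrite !Xb ?bp.
Qed.

Theorem theorem7 (disp : Order.disp_t) (Sigma : finOrderType disp)
    (S : numeration_system Sigma) (slenderL : slender (lang S)) (X : set nat) :
  recognizable S X <-> finite_union_of_arith_progs X.
Proof.
have [A SA] := lang_regular S; split=> [[B repB]|/finite_union_eventually_periodic Xper].
  apply: eventually_periodic_finite_union.
  have [d [_ Ld]] := slenderL.
  pose q0 := dfa_init A; pose r0 := dfa_init B.
  have led n : nb_words q0 n <= d.
    rewrite -card_le_II; have /card_eqPle[_ /card_le_trans] := card_seq_set (words_uniq q0 n).
    apply; rewrite (_ : [set` _] = [set w | lang S w /\ size w = n]); first exact: Ld.
    apply/seteqP; split=> w /=; rewrite SA mem_words.
      by move=> /andP[/eqP].
    by move=> [Lw ->]; rewrite eqxx.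
  apply: (concat_eventually_periodic (b := bits q0 r0)); last first.
  - exact: bits_eventually_periodic led.
  (* The word at index [i] of [words q0 n] has rank [i], so it represents [i] plus the number of
     shorter words. *)
  - move=> n i; rewrite size_map => lt_i.
    under eq_bigr do rewrite size_map.
    rewrite (nth_map [::]) // -(repK SA) repB.
    have := mem_nth [::] lt_i; rewrite mem_words => /andP[/eqP sw qw].
    have Lw : lang S (nth [::] (words q0 n) i) by rewrite SA.
    have := rep_position SA Lw.
    by rewrite /position sw (rank_nth lt_i) => ->.
  (* The block of [m] is the length of [rep S m], and its offset there is the rank of that word. *)
  - move=> m; have [+ _] := repP S m; rewrite SA => Lw.
    exists (size (rep S m)), (rank q0 (rep S m)).
    under eq_bigr do rewrite size_map.
    by rewrite size_map -[m in m = _](position_rep SA) (nth_rank Lw).1.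
rewrite /recognizable (_ : _ @` X = [set w | dfa_lang A w /\ X (position A w)]).
  exact: regular_preimage_position.
by rewrite -SA; apply/seteqP; split=> w /(rep_image SA).
Qed.
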